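(* Let $y \in L^2([0,2]^2)$ and suppose that $x^\dagger \in L^2([0,1]^2)$ is a solution to the autoconvolution equation $F(x)=y$ in the full data case, i.e. $[x^\dagger * x^\dagger](s_1,s_2)=y(s_1,s_2)$ for almost every $(s_1,s_2)\in[0,2]^2$. Then $x^\dagger$ and $-x^\dagger$ are the only solutions of this equation in the full data case; that is, if $x \in L^2([0,1]^2)$ satisfies $[x*x](s_1,s_2)=y(s_1,s_2)$ for almost every $(s_1,s_2)\in[0,2]^2$, then $x=x^\dagger$ or $x=-x^\dagger$ (as elements of $L^2([0,1]^2)$).
   Context: All functions are real-valued, and $L^2$ spaces are with respect to Lebesgue measure. A function $x\in L^2([0,1]^2)$ is regarded as an element of $L^2(\mathbb{R}^2)$ with (essential) support $\operatorname{supp}(x)\subseteq[0,1]^2$ by extending it by zero. The full data autoconvolution operator $F:L^2([0,1]^2)\to L^2([0,2]^2)$ is $F(x)=x*x$, given explicitly for $0\le s_1,s_2\le 2$ by $$[F(x)](s_1,s_2)=\int_{\max(s_2-1,0)}^{\min(s_2,1)}\int_{\max(s_1-1,0)}^{\min(s_1,1)} x(s_1-t_1,s_2-t_2)\,x(t_1,t_2)\,dt_1\,dt_2 .$$ For given $y\in L^2([0,2]^2)$, a solution to $F(x)=y$ in the full data case is a function $x\in L^2([0,1]^2)$ with $\operatorname{supp}(x)\subseteq[0,1]^2$ such that $[x*x](s_1,s_2)=y(s_1,s_2)$ for almost every $(s_1,s_2)\in[0,2]^2$. *)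

(* Defs.v *)
From HB Require Import structures.
From mathcomp Require Import all_boot all_order all_algebra.
From mathcomp Require Import all_classical all_reals all_analysis.
From mathcomp Require Import lra.
Set Implicit Arguments.
Unset Strict Implicit.
Unset Printing Implicit Defensive.
Import Order.TTheory GRing.Theory Num.Theory.
Import numFieldNormedType.Exports.
Local Open Scope classical_set_scope.
Local Open Scope ring_scope.

(* Elements of L^2 are represented by Borel functions, and equality in L^2 by
   almost-everywhere equality on the domain. *)

Section autoconvolution.
Context {R : realType}.
Implicit Types (D : set (R * R)) (f g x y : R * R -> R) (s t : R * R).

Definition plane_measure :
    {measure set (measurableTypeR R * measurableTypeR R) -> \bar R} :=
  (@lebesgue_measure R \x @lebesgue_measure R)%E.

Definition square (c : R) : set (R * R) := `[0, c] `*` `[0, c].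

(* [f \_ D] is the extension by zero of the restriction of [f] to [D] (the
   default [point] of [R] is [0]), so the values of [f] outside [D] play no
   role. *)
Definition inL2 D f : Prop := f \_ D \in Lfun plane_measure 2%:E.

(* [\int] is [Rintegral] here; for [f] and [g] square integrable the integrand
   is integrable for every [s]. *)
Definition convolution f g : R * R -> R :=
  fun s => \int[plane_measure]_t (f (s - t) * g t).

(* [F(x) = x * x], with [x] extended by zero outside of the unit square. *)
Definition autoconvolution x : R * R -> R :=
  convolution (x \_ (square 1)) (x \_ (square 1)).

Lemma autoconvolutionE x s : autoconvolution x s =
  \int[plane_measure]_(t in `[Num.max (s.1 - 1) 0, Num.min s.1 1] `*`
                            `[Num.max (s.2 - 1) 0, Num.min s.2 1])
    (x (s - t) * x t).
Proof.
rewrite Rintegral_mkcond; apply: eq_Rintegral => t _.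
have sq u : u \in square 1 = [&& 0 <= u.1 <= 1 & 0 <= u.2 <= 1].
  apply/idP/idP; first by rewrite inE => -[]/=; rewrite !in_itv/= => -> ->.
  by move=> /andP[u1 u2]; rewrite inE; split; rewrite /= in_itv/=.
have -> : (x \_ (square 1)) (s - t) * (x \_ (square 1)) t =
    if (s - t \in square 1) && (t \in square 1) then x (s - t) * x t else 0.
  by rewrite !patchE; case: ifP => //= _; [case: ifP => // _; rewrite mulr0|
                                          rewrite mul0r].
rewrite patchE; congr (if _ then _ else _); rewrite !sq /=.
apply/idP/idP.
- move=> /andP[/andP[/andP[? ?] /andP[? ?]] /andP[/andP[? ?] /andP[? ?]]].
  rewrite inE; split; rewrite /= in_itv/= ge_max le_min;
    by apply/andP; split; apply/andP; split; lra.
- rewrite inE => -[]/=; rewrite !in_itv/= !ge_max !le_min.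
  move=> /andP[/andP[? ?] /andP[? ?]] /andP[/andP[? ?] /andP[? ?]].
  by do ![apply/andP; split]; lra.
Qed.

(* The support condition [supp x `<=` [0,1]^2] is built in, through the
   extension by zero in [inL2] and [autoconvolution]. *)
Definition is_solution y x : Prop :=
  inL2 (square 1) x /\
  ae_eq plane_measure (square 2) (autoconvolution x) y.

End autoconvolution.

(* Main.v *)
(* The moments of [x * x] are the binomial convolution of the moments of [x]
   with themselves, by Fubini.  Hence two solutions [x] and [z] have moments
   whose exponential generating functions, formal power series in two
   variables, have the same square; these series form an integral domain, so
   all the moments of [x - z] or all those of [x + z] vanish.  An integrable
   function on the unit square with zero moments is zero almost everywhere:
   suitable polynomials in one coordinate converge boundedly to the indicator
   of a half-line, so the integrals over all rectangles vanish, and a Dynkin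
   class argument extends this to all measurable sets. *)

From HB Require Import structures.
Require Import Defs.
From mathcomp Require Import all_boot all_order all_algebra.
From mathcomp Require Import all_classical all_reals all_analysis.
From mathcomp Require Import measurable_realfun ring lra zify.
Set Implicit Arguments.
Unset Strict Implicit.
Unset Printing Implicit Defensive.
Import Order.TTheory GRing.Theory Num.Theory.
Import numFieldNormedType.Exports.
Local Open Scope classical_set_scope.
Local Open Scope ring_scope.

(** * Exponential generating functions in two variables: no zero divisors *)

Section binomial_product.
Context {R : numDomainType}.
Implicit Types a b : nat -> nat -> R.

(* The coefficients of the product of the exponential generating functions
   [\sum_(i, l) a i l * S^i/i! * T^l/l!] of [a] and of [b]. *)
Definition binomial_product a b n m : R :=
  \sum_(i < n.+1) \sum_(l < m.+1)
    ('C(n, i) * 'C(m, l))%:R * (a i l * b (n - i)%N (m - l)%N).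

Lemma binomial_productC a b n m :
  binomial_product a b n m = binomial_product b a n m.
Proof.
rewrite /binomial_product (reindex_inj rev_ord_inj)/=.
apply: eq_bigr => i _; rewrite (reindex_inj rev_ord_inj)/=.
apply: eq_bigr => l _; rewrite !subSS.
have le_in : (i <= n)%N := leq_ord i.
have le_lm : (l <= m)%N := leq_ord l.
rewrite (bin_sub le_in) (bin_sub le_lm) !subKn//.
by congr (_ * _); exact: mulrC.
Qed.

Lemma lex_min_neq0 a : (exists i l, a i l != 0) ->
  exists j k, [/\ a j k != 0, forall i l, (i < j)%N -> a i l = 0 &
                  forall l, (l < k)%N -> a j l = 0].
Proof.
move=> [i0 [l0 a0]].
have exj : exists i, `[< exists l, a i l != 0 >].
  by exists i0; apply/asboolP; exists l0.
have [j /asboolP exk jmin] := ex_minnP exj.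
have [k ak kmin] := ex_minnP exk.
exists j, k; split=> // [i l ij|l lk]; apply/eqP; apply: contraTT isT => ail.
- suff : (j <= i)%N by rewrite leqNgt ij.
  by apply: jmin; apply/asboolP; exists l.
- by have := kmin _ ail; rewrite leqNgt lk.
Qed.

(* The coefficient of the product at the sum of the lexicographically least
   indices of the nonzero coefficients of [a] and of [b] has only one term. *)
Lemma binomial_product_eq0 a b : (forall n m, binomial_product a b n m = 0) ->
  (forall i l, a i l = 0) \/ (forall i l, b i l = 0).
Proof.
move=> ab0; have [|/existsNP[i /existsNP[l /eqP ail]]] :=
  pselect (forall i l, a i l = 0); first by left.
right => i' l'; apply/eqP; apply: contrapT => /negP bil'.
have [j [k [ajk jmin kmin]]] :=
  lex_min_neq0 (ex_intro _ i (ex_intro _ l ail)).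
have [j' [k' [bjk jmin' kmin']]] :=
  lex_min_neq0 (ex_intro _ i' (ex_intro _ l' bil')).
have := ab0 (j + j')%N (k + k')%N; rewrite /binomial_product.
have jlt : (j < (j + j').+1)%N by rewrite ltnS leq_addr.
have klt : (k < (k + k').+1)%N by rewrite ltnS leq_addr.
rewrite (bigD1 (Ordinal jlt))//= [X in _ + X]big1 ?addr0; last first.
  move=> p; rewrite -val_eqE/= => pj; apply: big1 => q _.
  have [lepj|ltjp] := ltnP p j; first by rewrite jmin// mul0r mulr0.
  rewrite (jmin' (j + j' - p)%N) ?mulr0//.
  by have := ltn_ord p; move: pj ltjp; lia.
rewrite (bigD1 (Ordinal klt))//= [X in _ + X]big1 ?addr0; last first.
  move=> q; rewrite -val_eqE/= => qk.
  have [leqk|ltkq] := ltnP q k; first by rewrite kmin// mul0r mulr0.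
  rewrite addKn (kmin' (k + k' - q)%N) ?mulr0//.
  by have := ltn_ord q; move: qk ltkq; lia.
(* The surviving term carries ['C(j + j', j) * 'C(k + k', k)], which is nonzero because the
   characteristic is zero. *)
rewrite !addKn => /eqP; rewrite !mulf_eq0 (negPf ajk) (negPf bjk) orbF orbF.
by rewrite pnatr_eq0 eqn0Ngt muln_gt0 !bin_gt0 !leq_addr.
Qed.

(** Factor the difference of squares as [(a - b) (a + b)]: the cross terms cancel by commutativity,
    and there are no zero divisors. *)
Lemma binomial_product_sqr_inj a b :
  (forall n m, binomial_product a a n m = binomial_product b b n m) ->
  (forall i l, a i l - b i l = 0) \/ (forall i l, a i l + b i l = 0).
Proof.
move=> ab; apply: binomial_product_eq0 => n m.
transitivity (binomial_product a a n m + binomial_product a b n m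
  - (binomial_product b a n m + binomial_product b b n m)).
  rewrite /binomial_product -!big_split/= -sumrB; apply: eq_bigr => i _.
  rewrite -!big_split/= -sumrB; apply: eq_bigr => l _; ring.
by rewrite ab (binomial_productC b a) [X in X - _]addrC subrr.
Qed.

End binomial_product.

(** * Polynomials converging to a step function on the unit interval *)

Section step_polynomial.
Context {R : realType}.

Lemma bernoulli_ineq (x : R) n : 0 <= 1 + x -> 1 + n%:R * x <= (1 + x) ^+ n.
Proof.
move=> x1; elim: n => [|n IH]; first by rewrite mul0r addr0 expr0.
rewrite exprS; apply: (@le_trans _ _ ((1 + x) * (1 + n%:R * x))).
  rewrite -natr1 -subr_ge0.
  have -> : (1 + x) * (1 + n%:R * x) - (1 + (n%:R + 1) * x) = n%:R * x ^+ 2.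
    ring.
  by rewrite mulr_ge0 ?sqr_ge0.
by rewrite ler_wpM2l.
Qed.

(** The sum [1 + w + ... + w ^ (n - 1)] has [n] terms, each at least [w ^ n], and equals
    [(1 - w ^ n) / (1 - w)]. *)
Lemma natr_mul_expr_le (w : R) n : 0 <= w < 1 -> n%:R * w ^+ n <= (1 - w)^-1.
Proof.
move=> /andP[w0 w1]; rewrite -[leRHS]div1r ler_pdivlMr ?subr_gt0//.
suff : n%:R * w ^+ n * (1 - w) <= 1 - w ^+ n.
  by move/le_trans; apply; rewrite gerBl exprn_ge0.
elim: n => [|n IH]; first by rewrite !mul0r subrr.
have wn1 : w ^+ n.+1 <= 1 by rewrite exprn_ile1// ltW.
have := ler_wpM2l w0 IH; rewrite exprS -natr1.
move: wn1; rewrite exprS; set v := w ^+ n; nra.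
Qed.

(* The factor [n] in the exponent [n * 4 ^ n] makes the limit at the threshold
   [q = 1/2] equal to [0], so that the convergence to a step holds everywhere
   and no null set has to be discarded. *)
Definition step_sequence (q : R) n : R := (1 - q ^+ (n.*2)) ^+ (n * 4 ^ n).

(** With [N = n * 4 ^ n] and [x = q ^ (2 n)], one has [N x = n (2 q) ^ (2 n) >= n], and
    [(1 - x) ^ N] is at most [1 / (1 + N x)]. *)
Lemma step_sequence_ge_half (q : R) n : 2^-1 <= q <= 1 ->
  0 <= step_sequence q n <= n.+1%:R^-1.
Proof.
move=> /andP[q2 q1]; have q0 : 0 <= q by lra.
rewrite /step_sequence; set x := q ^+ _; set N := (n * _)%N.
have x0 : 0 <= x by rewrite exprn_ge0.
have x1 : x <= 1 by rewrite exprn_ile1.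
have Nx : n%:R <= N%:R * x.
  rewrite /N natrM -mulrA ler_peMr// natrX /x -muln2 mulnC exprM -exprMn.
  rewrite exprn_ege1// expr2; nra.
have x1' : 0 <= (1 - x) ^+ N by rewrite exprn_ge0// subr_ge0.
rewrite x1'/= -div1r ler_pdivlMr//.
(* [(1 - x) ^ N * (1 + N x) <= (1 - x ^ 2) ^ N <= 1] *)
apply: (@le_trans _ _ ((1 - x) ^+ N * (1 + x) ^+ N)).
  rewrite ler_wpM2l//; apply: le_trans (bernoulli_ineq N _); last by lra.
  by rewrite -natr1 addrC lerD2l.
by rewrite -exprMn exprn_ile1//; nra.
Qed.

(** Bernoulli's inequality bounds the power below by [1 - N x], where [N x = n (2 q) ^ (2 n)] is now
    small for large [n] because [2 q < 1]. *)
Lemma step_sequence_lt_half (q : R) n : 0 <= q < 2^-1 ->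
  1 - n%:R * (2 * q) ^+ n.*2 <= step_sequence q n <= 1.
Proof.
move=> /andP[q0 q2].
have x0 : 0 <= q ^+ n.*2 by rewrite exprn_ge0.
have x1 : q ^+ n.*2 <= 1 by rewrite exprn_ile1//; lra.
apply/andP; split; last by rewrite /step_sequence exprn_ile1//; lra.
apply: le_trans (bernoulli_ineq _ _); last by lra.
rewrite mulrN lerD2l lerN2 exprMn mulrA ler_wpM2r//.
by rewrite natrM natrX -muln2 mulnC exprM -[2 ^+ 2]natrX.
Qed.

Lemma step_sequence_cvg (q : R) : 0 <= q <= 1 ->
  step_sequence q @ \oo --> ((q < 2^-1)%R%:R : R).
Proof.
move=> /andP[q0 q1]; have [q2|q2] := ltP q 2^-1; last first.
  apply: (@squeeze_cvgr _ _ _ _ (cst 0) (@harmonic R)) => /=.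
  - by apply: nearW => n; apply: step_sequence_ge_half; rewrite q2.
  - exact: cvg_cst.
  - exact: cvg_harmonic.
have w0 : 0 <= 2 * q by lra.
have w1 : 2 * q < 1 by lra.
(* Of the two factors [(2 q) ^ n] in [(2 q) ^ (2 n)], one absorbs [n] at the price of the constant
   [1 / (1 - 2 q)], and the other tends to zero. *)
apply: (@squeeze_cvgr _ _ _ _
  (fun n => 1 - (1 - 2 * q)^-1 * (2 * q) ^+ n) (cst 1)).
- apply: nearW => n.
  have /andP[le1 ->] : _ := step_sequence_lt_half n (introT andP (conj q0 q2)).
  rewrite andbT; apply: le_trans le1; rewrite lerD2l lerN2.
  rewrite -addnn exprD mulrA ler_wpM2r ?exprn_ge0//.
  by apply: natr_mul_expr_le; rewrite w0.
- suff : (fun n => 1 - (1 - 2 * q)^-1 * (2 * q) ^+ n) @ \oo -->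
      (1 - (1 - 2 * q)^-1 * 0 : R) by rewrite mulr0 subr0.
  apply: cvgB; first exact: cvg_cst.
  by apply: cvgMr; apply: cvg_expr; rewrite ger0_norm.
- exact: cvg_cst.
Qed.

End step_polynomial.

(** * From vanishing moments to vanishing integrals over preimages *)

Section vanishing_integrals.
Context d (T : measurableType d) (R : realType).
Variable mu : {measure set T -> \bar R}.
Local Open Scope ereal_scope.

(** The sets whose preimage carries zero integral form a Dynkin class: complements use the zero
    total integral, disjoint unions countable additivity. This serves for half-lines under a
    coordinate and for rectangles under the identity. *)
Lemma integral_preimage_eq0 d' (T' : measurableType d') (G : set (set T'))
    (phi : T -> T') (f : T -> \bar R) :
  @measurable _ T' = <<s G >> -> setI_closed G ->
  measurable_fun setT phi -> mu.-integrable setT f ->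
  \int[mu]_t f t = 0 ->
  (forall A, G A -> \int[mu]_(t in phi @^-1` A) f t = 0) ->
  forall A, measurable A -> \int[mu]_(t in phi @^-1` A) f t = 0.
Proof.
move=> GE GI mphi intf fT fG A mA.
have mpre B : measurable B -> measurable (phi @^-1` B).
  by move=> mB; rewrite -[_ @^-1` _]setTI; exact: mphi.
have intfS B : measurable B -> mu.-integrable B f.
  by move=> mB; apply: integrableS intf.
apply: (dynkin_induction (P := fun B => \int[mu]_(t in phi @^-1` B) f t = 0)
  GE GI) => //; last by rewrite -GE.
- move=> S mS S0; move: fT; rewrite -(setUv (phi @^-1` S)) integral_setU//.
  + by rewrite S0 add0e.
  + exact: mpre.
  + by apply: measurableC; exact: mpre.
  + by rewrite setUv; exact: measurable_int intf.
  + by apply/disj_set2P; rewrite setICr.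
- move=> F mF tF F0; rewrite preimage_bigcup integral_bigcup//.
  + by apply: eseries0 => i _ _; exact: F0.
  + apply/trivIsetP => i j _ _ ij.
    move/trivIsetP : tF => /(_ i j Logic.I Logic.I ij).
    by rewrite /= -preimage_setI => ->; rewrite preimage_set0.
  + by move=> k; exact: mpre.
  + by apply: intfS; apply: bigcup_measurable => k _; exact: mpre.
Qed.

Section moments.
Variables (phi f : T -> R).
Hypothesis mphi : measurable_fun setT phi.
Hypothesis intf : mu.-integrable setT (EFin \o f).
(** The bound is asked only where [f] is nonzero, so that [phi] can be a coordinate function on the
    whole plane. *)
Hypothesis phi01 : forall t, f t != 0%R -> (0 <= phi t <= 1)%R.

Let integrable_moment n : mu.-integrable setT (fun t => (phi t ^+ n * f t)%:E).
Proof.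
apply: le_integrable intf => //.
  apply/measurable_EFinP; apply: measurable_funM; first exact: measurable_funX.
  by apply/measurable_EFinP; exact: measurable_int intf.
move=> t _; rewrite lee_fin /= normrM.
have [->|/phi01/andP[p0 p1]] := eqVneq (f t) 0%R; first by rewrite normr0 mulr0.
by rewrite ler_piMl// ger0_norm ?exprn_ge0// exprn_ile1.
Qed.

Let horner_momentE (p : {poly R}) : (fun t => (p.[phi t] * f t)%:E) =
  fun t => \sum_(i < size p) (p`_i)%:E * ((phi t ^+ i * f t)%R)%:E.
Proof.
apply/funext => t; rewrite horner_coef mulr_suml -sumEFin.
by apply: eq_bigr => i _; rewrite -EFinM mulrA.
Qed.

Let integrable_horner (p : {poly R}) :
  mu.-integrable setT (fun t => (p.[phi t] * f t)%:E).
Proof.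
rewrite horner_momentE; apply: integrable_sum => // i _.
by apply: integrableZl => //; exact: integrable_moment.
Qed.

Hypothesis moment0 : forall n, \int[mu]_t ((phi t ^+ n * f t)%R)%:E = 0.

Let integral_horner (p : {poly R}) : \int[mu]_t (p.[phi t] * f t)%:E = 0.
Proof.
rewrite horner_momentE integral_sum//; last first.
  by move=> i; apply: integrableZl => //; exact: integrable_moment.
by apply: big1 => i _; rewrite integralZl ?moment0 ?mule0.
Qed.

(** After an affine change of variable sending [a] to [1/2], the step polynomials are still
    polynomials in [phi], so their integrals against [f] vanish. Dominated convergence, with bound
    [|f|], passes to the indicator of [phi < a]. *)
Lemma integral_halfline_eq0 a :
  \int[mu]_(t in phi @^-1` `]-oo, a[%classic) (f t)%:E = 0.
Proof.
(* Where [f] is nonzero, [|phi - a| <= 1 + |a|], so this slope keeps [q] within distance [1/2] of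
   [1/2]. *)
pose c : R := (2 * (1 + `|a|))^-1%R.
have a1 : (0 < 1 + `|a|)%R by rewrite ltr_pwDl.
have c0 : (0 < c)%R by rewrite invr_gt0 mulr_gt0.
pose q t : R := (2^-1 + c * (phi t - a))%R.
have q01 t : f t != 0%R -> (0 <= q t <= 1)%R.
  move=> /phi01/andP[p0 p1].
  have : (`|phi t - a| <= 1 + `|a|)%R.
    by rewrite (le_trans (ler_normB _ _))// lerD2r ger0_norm.
  have cE : (c * (1 + `|a|) = 2^-1)%R by rewrite /c; field; rewrite gt_eqF.
  rewrite -(ler_pM2l c0) cE => ca.
  have : (`|c * (phi t - a)| <= 2^-1)%R by rewrite normrM gtr0_norm.
  by rewrite ler_norml /q => /andP[? ?]; apply/andP; split; lra.
have qa t : (q t < 2^-1)%R = (phi t < a)%R.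
  by rewrite /q gtrDl pmulr_rlt0// subr_lt0.
pose Q : {poly R} := (2^-1%:P + c *: ('X - a%:P))%R.
pose S n : {poly R} := ((1 - Q ^+ n.*2) ^+ (n * 4 ^ n))%R.
have SE n t : (S n).[phi t] = step_sequence (q t) n.
  by rewrite /S /Q !hornerE.
pose g := (EFin \o f) \_ (phi @^-1` `]-oo, a[).
have mA : measurable (phi @^-1` `]-oo, a[).
  by rewrite -[_ @^-1` _]setTI; exact: mphi.
have mf : measurable_fun setT (EFin \o f) by exact: measurable_int intf.
have [|||||_ _] := @dominated_convergence _ _ _ mu _ measurableT
    (fun n t => ((S n).[phi t] * f t)%:E) g (abse \o (EFin \o f)).
- by move=> n; exact: measurable_int (integrable_horner (S n)).
- by apply/(measurable_restrictT _ mA); exact: measurable_funTS.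
- apply/aeW => t _; rewrite /g patchE.
  (* Where [f] vanishes, [q t] may leave [[0, 1]] and the step polynomials may diverge, but the
     products are zero. *)
  have [f0|f0] := eqVneq (f t) 0%R.
    under eq_fun do rewrite f0 mulr0.
    by rewrite /= f0 if_same; exact: cvg_cst.
  have -> : (if t \in phi @^-1` `]-oo, a[ then (EFin \o f) t else point) =
      ((q t < 2^-1)%R%:R * f t)%:E.
    rewrite qa; case: ifPn => [|/negP]; rewrite inE/= in_itv/=.
      by move=> ->; rewrite mul1r.
    by move=> /negP/negPf ->; rewrite mul0r.
  apply: cvg_EFin; first exact: nearW.
  under eq_fun do rewrite /= SE.
  by apply: cvgMl; exact: step_sequence_cvg (q01 _ f0).
- exact: integrable_abse.
- apply/aeW => t n _; rewrite /= lee_fin normrM.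
  have [->|f0] := eqVneq (f t) 0%R; first by rewrite normr0 mulr0.
  rewrite ler_piMl// SE; have /andP[q0 q1] := q01 _ f0.
  have x1 : (q t ^+ n.*2 <= 1)%R by rewrite exprn_ile1.
  have x0 : (0 <= q t ^+ n.*2)%R by rewrite exprn_ge0.
  rewrite ger0_norm /step_sequence; first by rewrite exprn_ile1; lra.
  by rewrite exprn_ge0; lra.
under eq_fun do rewrite integral_horner.
rewrite /g -integral_mkcond => h.
by apply: cvg_unique h _ => //; exact: cvg_cst.
Qed.

Lemma integral_moment0_preimage (A : set (measurableTypeR R)) : measurable A ->
  \int[mu]_(t in phi @^-1` A) (f t)%:E = 0.
Proof.
move=> mA.
refine (@integral_preimage_eq0 _ (measurableTypeR R) (@RGenInftyO.G R) phi
  (EFin \o f) _ _ mphi intf _ _ A mA).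
- exact: RGenInftyO.measurableE.
- move=> _ _ [x ->] [y ->]; exists (Num.min x y).
  by apply/seteqP; split => z /=; rewrite !in_itv/= lt_min => /andP.
(* The total integral is the one against the constant polynomial. *)
- rewrite -(integral_horner 1).
  by under [RHS]eq_integral do rewrite hornerE mul1r.
- by move=> _ [x ->]; exact: integral_halfline_eq0.
Qed.

End moments.

End vanishing_integrals.

(** * Lebesgue measure on the plane: vanishing moments and translations *)

Section plane.
Context {R : realType}.
Local Notation lebR := (@lebesgue_measure R).
Local Notation planeT := (measurableTypeR R * measurableTypeR R)%type.
Local Open Scope ereal_scope.

Lemma sigma_finite_plane : sigma_finite setT (@plane_measure R).
Proof.
pose F n : set (measurableTypeR R) := `[- n%:R, n%:R]%classic%R.
exists (fun n => F n `*` F n) => [|n].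
  apply/seteqP; split => // t _.
  exists (Num.truncn `|t.1| + Num.truncn `|t.2|).+1%N => //.
  have tn (x : R) m : (`|x| <= m%:R)%R -> F m x.
    by rewrite ler_norml /F /= in_itv.
  have tr (x : R) m : (Num.truncn `|x| < m)%N -> (`|x| <= m%:R)%R.
    move=> xm; apply: ltW; apply: lt_le_trans (truncnS_gt _) _.
    by rewrite ler_nat.
  by split; apply/tn/tr; rewrite ltnS ?leq_addr ?leq_addl.
split; first by apply: measurableX; exact: measurable_itv.
have mF : measurable (F n) by exact: measurable_itv.
have -> : plane_measure (F n `*` F n) = lebR (F n) * lebR (F n).
  exact: product_measure1E.
rewrite lebesgue_measure_itv/=.
by case: ifP => _; rewrite ?mule0 -?EFinB -?EFinM ltry.
Qed.

(* A copy of [plane_measure] that can carry the sigma-finite structure required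
   by Fubini's theorem. *)
Definition plane : set planeT -> \bar R := lebR \x lebR.

HB.instance Definition _ := Measure.on plane.
HB.instance Definition _ :=
  Measure_isSigmaFinite.Build _ _ _ plane sigma_finite_plane.

Lemma neq0_in_square (f : planeT -> R) t :
  (forall t, t \notin square 1 -> f t = 0%R) ->
  f t != 0%R -> ((0 <= t.1 <= 1) && (0 <= t.2 <= 1))%R.
Proof.
move=> f0 /eqP ft; have : t \in square 1 by apply/negP => /negP /f0.
by rewrite inE => -[]; rewrite /= !in_itv/= => -> ->.
Qed.

(** The coordinates are treated one at a time. For fixed [l], the one-variable result in the first
    coordinate applies to [t.2 ^ l * f]. It yields that [f], cut down to the points with first
    coordinate in [A], has zero moments in the second coordinate, so the same result applies again
    and gives rectangles. *)
Lemma plane_moments_eq0 (f : planeT -> R) :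
  plane.-integrable setT (EFin \o f) ->
  (forall t, t \notin square 1 -> f t = 0%R) ->
  (forall i l, \int[plane]_t ((t.1 ^+ i * t.2 ^+ l * f t)%R)%:E = 0) ->
  ae_eq plane setT f (cst 0%R).
Proof.
move=> intf f01 m0.
have mf : measurable_fun setT f.
  by apply/measurable_EFinP; exact: measurable_int intf.
have intl l : plane.-integrable setT (EFin \o (fun t => t.2 ^+ l * f t)%R).
  apply: le_integrable intf => //.
    apply/measurable_EFinP; apply: measurable_funM => //.
    by apply: measurable_funX; exact: measurable_snd.
  move=> t _; rewrite lee_fin /= normrM.
  have [->|/(neq0_in_square f01)/andP[_ /andP[t0 t1]]] := eqVneq (f t) 0%R.
    by rewrite normr0 mulr0.
  by rewrite ler_piMl// ger0_norm ?exprn_ge0// exprn_ile1.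
have fst0 l A : measurable A ->
    \int[plane]_(t in fst @^-1` A) (t.2 ^+ l * f t)%:E = 0.
  move=> mA; apply: (@integral_moment0_preimage _ _ _ plane fst
    (fun t => t.2 ^+ l * f t)%R) => //.
  - move=> t; rewrite mulf_eq0 negb_or => /andP[_].
    by move=> /(neq0_in_square f01)/andP[].
  - by move=> n; rewrite -[RHS](m0 n l); apply: eq_integral => t _; rewrite mulrA.
have X0 A B : measurable A -> measurable B ->
    \int[plane]_(t in A `*` B) (f t)%:E = 0.
  move=> mA mB.
  have mfA : measurable (fst @^-1` A : set planeT).
    by rewrite -[_ @^-1` _]setTI; exact: measurable_fst.
  pose g := f \_ (fst @^-1` A).
  have gE : EFin \o g = (EFin \o f) \_ (fst @^-1` A).
    by rewrite /g restrict_EFin.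
  have -> : A `*` B = (snd @^-1` B : set planeT) `&` fst @^-1` A.
    by apply/seteqP; split => t [].
  rewrite integral_mkcondr -gE.
  apply: (@integral_moment0_preimage _ _ _ plane snd) => //.
  - by rewrite gE; apply/(integrable_mkcond _ mfA); exact: integrableS intf.
  - move=> t; rewrite /g patchE; case: ifP => // [_|]; last by rewrite eqxx.
    by move=> /(neq0_in_square f01)/andP[].
  - move=> n; rewrite -[RHS](fst0 n A mA) [RHS]integral_mkcond.
    apply: eq_integral => t _; rewrite /g !patchE; case: ifP => //.
    by rewrite mulr0.
suff : ae_eq plane setT (EFin \o f) (cst 0).
  by apply: filterS => t /(_ Logic.I) /= [].
(* It suffices that the integral over every measurable set is zero; rectangles generate these sets
   and are stable under intersection. *)
apply: integral_ae_eq => // E _ mE; rewrite integral0.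
apply: (@integral_preimage_eq0 _ _ _ plane _ planeT
  [set A `*` B | A in measurable & B in measurable] id (EFin \o f)) => //.
- exact: measurable_prod_measurableType.
- move=> _ _ [A mA [B mB <-]] [A' mA' [B' mB' <-]].
  exists (A `&` A'); first exact: measurableI.
  by exists (B `&` B'); [exact: measurableI|rewrite setXI].
- by rewrite -setXTT; apply: X0.
- by move=> _ [A mA [B mB <-]]; exact: X0.
Qed.

(** Lebesgue measure is determined by its values on half-open intervals, and translation preserves
    their length. *)
Lemma lebesgue_measure_translate (a : R) (A : set (measurableTypeR R)) :
  measurable A -> lebR ((fun s => s - a)%R @^-1` A) = lebR A.
Proof.
move=> mA.
have ma : measurable_fun setT
    ((fun s => s - a)%R : measurableTypeR R -> measurableTypeR R).
  exact: measurable_funB.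
rewrite -[LHS]/(pushforward lebR
  (fun s : measurableTypeR R => s - a : measurableTypeR R)%R A).
apply/esym/lebesgue_measure_unique => //= _ [[b c]] _ <-.
rewrite /pushforward.
have -> : (fun s => s - a)%R @^-1` `]b, c]%classic =
    `](b + a)%R, (c + a)%R]%classic.
  by apply/seteqP; split => s /=; rewrite !in_itv/= ltrBrDr lerBlDr.
rewrite !lebesgue_measure_itv/= !lte_fin ltrD2r; case: ifP => // _.
by rewrite -!EFinB; congr EFin; ring.
Qed.

Lemma measurable_sub_plane d (T : measurableType d) (u v : T -> planeT) :
  measurable_fun setT u -> measurable_fun setT v ->
  measurable_fun setT (fun t => u t - v t : planeT)%R.
Proof.
move=> /measurable_fun_pairP[u1 u2] /measurable_fun_pairP[v1 v2].
apply: (@measurable_fun_pair _ _ _ T (measurableTypeR R) (measurableTypeR R)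
  (fun t => (u t).1 - (v t).1)%R (fun t => (u t).2 - (v t).2)%R).
  exact: (@measurable_funB _ T R setT (fst \o u) (fst \o v)).
exact: (@measurable_funB _ T R setT (snd \o u) (snd \o v)).
Qed.

(** A product measure is determined by its values on rectangles, where translation acts on each side
    separately. *)
Lemma plane_translate (a : R * R) (A : set planeT) : measurable A ->
  plane ((fun s => s - a)%R @^-1` A) = plane A.
Proof.
move=> mA.
have ma : measurable_fun setT ((fun s => s - a)%R : planeT -> planeT).
  by apply: measurable_sub_plane => //; exact: measurable_id.
rewrite -[LHS]/(pushforward plane (fun s : planeT => s - a : planeT)%R A).
apply/esym/product_measure_unique => //= B C mB mC.
rewrite /pushforward.
have -> : (fun s => s - a)%R @^-1` (B `*` C) =
   ((fun s => s - a.1)%R @^-1` B) `*` ((fun s => s - a.2)%R @^-1` C) by [].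
have mt (b : R) (D : set (measurableTypeR R)) : measurable D ->
    measurable ((fun s => s - b)%R @^-1` D : set (measurableTypeR R)).
  by move=> mD; rewrite -[_ @^-1` _]setTI; exact: measurable_funB.
rewrite [LHS]product_measure1E; [|exact: mt|exact: mt].
by congr (_ * _); exact: lebesgue_measure_translate.
Qed.

Lemma ge0_integral_plane_translate (a : R * R) (h : planeT -> \bar R) :
  measurable_fun setT h -> (forall t, 0 <= h t) ->
  \int[plane]_s h (s - a)%R = \int[plane]_s h s.
Proof.
move=> mh h0.
have ma : measurable_fun setT ((fun s => s - a)%R : planeT -> planeT).
  by apply: measurable_sub_plane => //; exact: measurable_id.
transitivity (\int[pushforward plane
    ((fun s => s - a)%R : planeT -> planeT)]_s h s).
  by rewrite ge0_integral_pushforward.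
apply: eq_measure_integral => A mA _; exact: plane_translate.
Qed.

Lemma integral_plane_translate (a : R * R) (h : planeT -> \bar R) :
  plane.-integrable setT h ->
  \int[plane]_s h (s - a)%R = \int[plane]_s h s.
Proof.
move=> ih; have mh := measurable_int _ ih.
rewrite integralE [RHS]integralE.
rewrite -(ge0_integral_plane_translate a (measurable_funepos mh))//.
rewrite -(ge0_integral_plane_translate a (measurable_funeneg mh))//.
by congr (_ - _); apply: eq_integral => s _;
  rewrite ?funeposE ?funenegE.
Qed.

End plane.

(** * Moments of an autoconvolution *)

Section autoconvolution_moments.
Context {R : realType}.
Local Notation planeT := (measurableTypeR R * measurableTypeR R)%type.
Variable X : planeT -> R.
Hypothesis intX : plane.-integrable setT (EFin \o X).
Hypothesis X01 : forall t, t \notin square 1 -> X t = 0.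

Definition monomial_mul (f : planeT -> R) i l (t : planeT) : R :=
  t.1 ^+ i * t.2 ^+ l * f t.

Definition moment (f : planeT -> R) i l : R :=
  \int[plane]_t monomial_mul f i l t.

Local Open Scope ereal_scope.

Let mX : measurable_fun setT X.
Proof. by apply/measurable_EFinP; exact: measurable_int intX. Qed.

Let measurable_monomial i l d (T : measurableType d) (u : T -> planeT) :
  measurable_fun setT u ->
  measurable_fun setT (fun t => (u t).1 ^+ i * (u t).2 ^+ l)%R.
Proof.
move=> /measurable_fun_pairP[u1 u2].
by apply: measurable_funM; apply: measurable_funX.
Qed.

Lemma integrable_monomial_mul i l :
  plane.-integrable setT (EFin \o monomial_mul X i l).
Proof.
apply: le_integrable intX => //.
  apply/measurable_EFinP; apply: measurable_funM => //.
  by apply: measurable_monomial; exact: measurable_id.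
move=> t _; rewrite lee_fin /= normrM.
have [->|Xt] := eqVneq (X t) 0%R; first by rewrite normr0 mulr0.
have /andP[/andP[t1 t1'] /andP[t2 t2']] := neq0_in_square X01 Xt.
rewrite ler_piMl// ger0_norm ?mulr_ge0 ?exprn_ge0//.
by rewrite mulr_ile1 ?exprn_ge0// exprn_ile1.
Qed.

Lemma momentE i l : \int[plane]_t (monomial_mul X i l t)%:E = (moment X i l)%:E.
Proof.
rewrite /moment fineK//; apply: integrable_fin_num => //.
exact: integrable_monomial_mul.
Qed.

Let measurable_kernel : measurable_fun setT
  (fun z : planeT * planeT => X (z.1 - z.2) * X z.2)%R.
Proof.
apply: measurable_funM.
  apply: (measurableT_comp mX); apply: measurable_sub_plane.
  - exact: measurable_fst.
  - exact: measurable_snd.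
by apply: (measurableT_comp mX); exact: measurable_snd.
Qed.

(** By Tonelli: for fixed [t], translation invariance makes the inner integral [|X t|] times the L1
    norm of [X], so the double integral is the square of that norm. *)
Lemma integrable_autoconvolution_kernel :
  (plane \x plane).-integrable setT (fun z => (X (z.1 - z.2) * X z.2)%:E).
Proof.
apply/integrable21ltyP; first by apply/measurable_EFinP; exact: measurable_kernel.
have intN := (integrableP _ _ _ intX).2.
have mN : measurable_fun setT (fun t => `|(X t)%:E|).
  by apply: measurableT_comp => //; exact: measurable_int intX.
have inner t : \int[plane]_s `|(X (s - t) * X t)%:E| =
    `|X t|%:E * \int[plane]_s `|(X s)%:E|.
  rewrite -(@ge0_integral_plane_translate _ t (fun s => `|(X s)%:E|))//.
  rewrite -ge0_integralZl_EFin//.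
    by apply: eq_integral => s _; rewrite EFinM abseM muleC.
  apply: (@measurableT_comp _ _ _ _ _ _ _ _
    (fun s : planeT => (s - t)%R : planeT) mN).
  by apply: measurable_sub_plane => //; exact: measurable_id.
under eq_integral do rewrite inner.
rewrite ge0_integralZr//; last by apply: integral_ge0.
by apply: lte_mul_pinfty => //; rewrite ?ge0_fin_numE ?integral_ge0.
Qed.

(** Where the kernel is nonzero, [z.1 = (z.1 - z.2) + z.2] is a sum of two points of the unit
    square, so the monomial is at most [2 ^ n * 2 ^ m]. *)
Lemma integrable_weighted_kernel n m : (plane \x plane).-integrable setT
  (fun z : planeT * planeT =>
    (z.1.1 ^+ n * z.1.2 ^+ m * (X (z.1 - z.2) * X z.2))%:E).
Proof.
apply: (le_integrable _ _ _
  (integrableZl measurableT (2 ^+ n * 2 ^+ m)%R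
    integrable_autoconvolution_kernel)) => //.
  apply/measurable_EFinP; apply: measurable_funM; last exact: measurable_kernel.
  by apply: measurable_monomial; exact: measurable_fst.
move=> z _; rewrite -EFinM lee_fin /= normrM [leRHS]normrM.
have [->|] := eqVneq (X (z.1 - z.2) * X z.2)%R 0%R.
  by rewrite normr0 !mulr0.
rewrite mulf_eq0 negb_or => /andP[/(neq0_in_square X01)/= + /(neq0_in_square X01)].
move=> /andP[/andP[a1 a2] /andP[a3 a4]] /andP[/andP[b1 b2] /andP[b3 b4]].
have le2 (x : R) k : (0 <= x <= 2)%R -> (`|x ^+ k| <= 2 ^+ k)%R.
  by move=> /andP[x0 x2]; rewrite ger0_norm ?exprn_ge0// lerXn2r ?nnegrE.
rewrite ler_wpM2r// [leRHS]ger0_norm ?mulr_ge0// normrM.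
by apply: ler_pM => //; apply: le2; apply/andP; split; lra.
Qed.

(** Fubini lets [s] be integrated first, the substitution [s = u + t] turns [X (s - t)] into [X u],
    and the binomial theorem splits the monomial in [u + t] into products of a function of [u] and a
    function of [t]. *)
Lemma integral_weighted_autoconvolution n m :
  \int[plane]_s \int[plane]_t
    (s.1 ^+ n * s.2 ^+ m * (X (s - t) * X t))%:E =
  (binomial_product (moment X) (moment X) n m)%:E.
Proof.
rewrite (Fubini (integrable_weighted_kernel n m))/=.
pose c (q : 'I_n.+1 * 'I_m.+1) (t : planeT) : R :=
  (('C(n, q.1) * 'C(m, q.2))%:R * monomial_mul X (n - q.1) (m - q.2) t)%R.
have cE (u t : planeT) :
    ((u + t).1 ^+ n * (u + t).2 ^+ m * (X u * X t))%:E =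
    \sum_(q : 'I_n.+1 * 'I_m.+1) (c q t)%:E * (monomial_mul X q.1 q.2 u)%:E.
  under eq_bigr do rewrite -EFinM.
  rewrite sumEFin; congr EFin.
  (* The summands are swapped so that the binomial index becomes the exponent of [u] rather than of
     [t]. *)
  rewrite /= addrC [in X in (_ * X * _)%R]addrC !exprDn big_distrlr/= pair_bigA/=.
  rewrite mulr_suml; apply: eq_bigr => q _; rewrite /c /monomial_mul natrM.
  by rewrite -[in LHS]mulr_natr -[X in (_ * X * _)%R]mulr_natr; ring.
transitivity (\int[plane]_t \sum_(q : 'I_n.+1 * 'I_m.+1)
    (c q t)%:E * (moment X q.1 q.2)%:E).
  apply: eq_integral => t _.
  have intc (q : 'I_n.+1 * 'I_m.+1) : plane.-integrable setT
      (fun u => (c q t)%:E * (monomial_mul X q.1 q.2 u)%:E).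
    by apply: integrableZl => //; exact: integrable_monomial_mul.
  (* The integrand as a function of [u = s - t], so that translation invariance applies. *)
  pose h (u : planeT) := ((u + t).1 ^+ n * (u + t).2 ^+ m * (X u * X t))%:E.
  transitivity (\int[plane]_s h (s - t)%R).
    by apply: eq_integral => s _; rewrite /h subrK.
  rewrite integral_plane_translate; last first.
    by rewrite /h (funext (cE ^~ t)); apply: integrable_sum.
  rewrite /h (funext (cE ^~ t)) integral_sum//.
  apply: eq_bigr => q _; rewrite integralZl ?momentE//.
  exact: integrable_monomial_mul.
have intc (q : 'I_n.+1 * 'I_m.+1) : plane.-integrable setT
   (fun t => ('C(n, q.1) * 'C(m, q.2))%:R%:E *
     (monomial_mul X (n - q.1) (m - q.2) t)%:E).
  by apply: integrableZl => //; exact: integrable_monomial_mul.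
rewrite integral_sum//; last first.
  by move=> q; apply: integrableZr => //; exact: intc.
rewrite /binomial_product pair_bigA/= -(sumEFin _ predT); apply: eq_bigr => q _.
rewrite integralZr//; last exact: intc.
have -> : \int[plane]_t (c q t)%:E =
    (('C(n, q.1) * 'C(m, q.2))%:R * moment X (n - q.1) (m - q.2))%:E.
  rewrite EFinM -momentE -integralZl//; exact: integrable_monomial_mul.
by rewrite -EFinM; congr EFin; ring.
Qed.

End autoconvolution_moments.

(** * Uniqueness up to sign *)

Section uniqueness.
Context {R : realType}.
Local Notation planeT := (measurableTypeR R * measurableTypeR R)%type.
Implicit Types (X Z : planeT -> R).
Local Open Scope ereal_scope.

(** [convolution] is real-valued, with default value zero where the extended integral is infinite.
    For integrable [X], Fubini makes the kernel integrable in [t] for almost every [s], and there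
    the monomial can be pulled out. *)
Lemma integral_weighted_convolution_ae X n m :
  plane.-integrable setT (EFin \o X) ->
  (forall t, t \notin square 1 -> X t = 0%R) ->
  {ae plane, forall s : planeT,
     \int[plane]_t (s.1 ^+ n * s.2 ^+ m * (X (s - t) * X t))%:E =
     (s.1 ^+ n * s.2 ^+ m * convolution X X s)%:E}.
Proof.
move=> intX X01.
have := ae_integrable1 (integrable_autoconvolution_kernel intX).
apply: filterS => s /= ints; rewrite EFinM /convolution /Rintegral fineK.
  by rewrite -integralZl.
exact: integrable_fin_num.
Qed.

(** A nonzero integrand at [t] makes [s = (s - t) + t] a sum of two points of the unit square. This
    lets an equality known on [square 2] be used in moment integrals over the whole plane. *)
Lemma convolution_outside X s :
  (forall t, t \notin square 1 -> X t = 0%R) ->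
  s \notin square 2 -> convolution X X s = 0%R.
Proof.
move=> X01; apply: contraNeq => Xs; rewrite inE.
have [t] : exists t, (X (s - t) * X t != 0)%R.
  apply: contrapT => /forallNP X0; move/eqP: Xs; apply.
  transitivity (\int[plane]_t (cst 0 t : R))%R; last first.
    by rewrite Rintegral_cst// mul0r.
  apply: eq_Rintegral => t _.
  by apply/eqP; apply: contrapT => /negP; exact: X0.
rewrite mulf_eq0 negb_or => /andP[/(neq0_in_square X01)/= + /(neq0_in_square X01)].
move=> /andP[/andP[a1 a2] /andP[a3 a4]] /andP[/andP[b1 b2] /andP[b3 b4]].
by split; rewrite /= in_itv/=; apply/andP; split; lra.
Qed.

Lemma binomial_moments_eq X Z :
  plane.-integrable setT (EFin \o X) ->
  (forall t, t \notin square 1 -> X t = 0%R) ->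
  plane.-integrable setT (EFin \o Z) ->
  (forall t, t \notin square 1 -> Z t = 0%R) ->
  ae_eq plane (square 2) (convolution X X) (convolution Z Z) ->
  forall n m, binomial_product (moment X) (moment X) n m =
              binomial_product (moment Z) (moment Z) n m.
Proof.
move=> intX X01 intZ Z01 XZ n m; apply: EFin_inj.
rewrite -(integral_weighted_autoconvolution intX X01).
rewrite -(integral_weighted_autoconvolution intZ Z01).
apply: ae_eq_integral => //.
- exact: measurable_fubini_F (integrable_weighted_kernel intX X01 n m).
- exact: measurable_fubini_F (integrable_weighted_kernel intZ Z01 n m).
have := integral_weighted_convolution_ae n m intX X01.
have := integral_weighted_convolution_ae n m intZ Z01.
apply: filterS3 XZ => s XZs /= Zs Xs _; rewrite [LHS]Xs [RHS]Zs.
have [s2|s2] := boolP (s \in square 2).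
  by rewrite XZs//; apply: set_mem.
by rewrite !convolution_outside.
Qed.

(** By linearity, the moments of [X - Z] and of [X + Z] are the differences and the sums of the
    moments, and one of these two families vanishes identically. *)
Lemma convolution_sqr_inj X Z :
  plane.-integrable setT (EFin \o X) ->
  (forall t, t \notin square 1 -> X t = 0%R) ->
  plane.-integrable setT (EFin \o Z) ->
  (forall t, t \notin square 1 -> Z t = 0%R) ->
  ae_eq plane (square 2) (convolution X X) (convolution Z Z) ->
  ae_eq plane setT X Z \/ ae_eq plane setT X (\- Z)%R.
Proof.
move=> intX X01 intZ Z01 XZ.
have mD : forall i l, \int[plane]_t (monomial_mul (X \- Z) i l t)%:E =
    (moment X i l - moment Z i l)%:E.
  move=> i l; rewrite EFinB -!momentE// -integralB_EFin//.
  + by apply: eq_integral => t _; rewrite -EFinB /monomial_mul mulrBr.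
  + exact: integrable_monomial_mul.
  + exact: integrable_monomial_mul.
have mS : forall i l, \int[plane]_t (monomial_mul (X \+ Z) i l t)%:E =
    (moment X i l + moment Z i l)%:E.
  move=> i l; rewrite EFinD -!momentE// -integralD_EFin//.
  + by apply: eq_integral => t _; rewrite -EFinD /monomial_mul mulrDr.
  + exact: integrable_monomial_mul.
  + exact: integrable_monomial_mul.
have [m0|m0] :=
  binomial_product_sqr_inj (binomial_moments_eq intX X01 intZ Z01 XZ).
- left; have : ae_eq plane setT (X \- Z)%R (cst 0%R).
    apply: plane_moments_eq0.
    + exact: (integrableB measurableT intX intZ).
    + by move=> t t1; rewrite /= X01// Z01// subr0.
    + by move=> i l; rewrite -[RHS](congr1 EFin (m0 i l)) -mD.
  by apply: filterS => t /= /(_ Logic.I) /eqP; rewrite subr_eq0 => /eqP.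
- right; have : ae_eq plane setT (X \+ Z)%R (cst 0%R).
    apply: plane_moments_eq0.
    + exact: (integrableD measurableT intX intZ).
    + by move=> t t1; rewrite /= X01// Z01// addr0.
    + by move=> i l; rewrite -[RHS](congr1 EFin (m0 i l)) -mS.
  by apply: filterS => t /= /(_ Logic.I) /eqP; rewrite addr_eq0 => /eqP.
Qed.

Lemma restrict_notin (x : planeT -> R) t : t \notin square 1 ->
  (x \_ (square 1)) t = 0%R.
Proof. by rewrite patchE => /negPf ->. Qed.

(** The square has finite measure, and [|X| <= 1 + X ^ 2] on it. *)
Lemma inL2_integrable (x : planeT -> R) : inL2 (square 1) x ->
  plane.-integrable setT (EFin \o (x \_ (square 1))).
Proof.
rewrite /inL2; set X := x \_ _ => X2.
have mS : measurable (square 1 : set planeT).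
  by apply: measurableX; exact: measurable_itv.
have mX : measurable_fun setT X by exact: set_mem (sub_Lfun_mfun X2).
have iS : plane.-integrable setT (EFin \o (\1_(square 1) : planeT -> R)).
  apply/integrableP; split; first by apply/measurable_EFinP;
    exact: measurable_indic.
  under eq_integral do rewrite /= ger0_norm//.
  rewrite integral_indic// setIT.
  rewrite [X in X < _]product_measure1E//=; [|exact: measurable_itv..].
  by rewrite lebesgue_measure_itv/= lte01 -EFinB -EFinM ltry.
apply: (le_integrable measurableT _ _
  (integrableD measurableT iS (Lfun2_integrable_sqr X2))).
  exact/measurable_EFinP.
move=> t _; rewrite /= lee_fin.
have [tS|tS] := boolP (t \in square 1); last first.
  by rewrite /X restrict_notin// normr0.
rewrite indicE tS /= [leRHS]ger0_norm; last by rewrite addr_ge0// sqr_ge0.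
rewrite -real_normK ?num_real//; set a := `|X t|%R; nra.
Qed.

End uniqueness.

Theorem theorem1 (R : realType) (y xdag : R * R -> R)
  (hy : inL2 (square 2) y) (hxdag : is_solution y xdag) :
  is_solution y (\- xdag) /\
  forall x : R * R -> R, is_solution y x ->
    ae_eq plane_measure (square 1) x xdag \/
    ae_eq plane_measure (square 1) x (\- xdag).
Proof.
case: hxdag => xdag2 xdagy.
have opp_restrict : (\- xdag) \_ (square 1) = \- (xdag \_ (square 1)).
  by apply/funext => t; rewrite /= !patchE; case: ifP => // _; rewrite oppr0.
split.
  split.
    rewrite /inL2 opp_restrict; exact: (Lfun_oppr_closed xdag2).
  suff -> : autoconvolution (\- xdag) = autoconvolution xdag by [].
  rewrite /autoconvolution opp_restrict; apply/funext => s.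
  by apply: eq_Rintegral => t _; rewrite /= mulrNN.
move=> x [x2 xy].
have sub1 (u v : R * R -> R) :
    ae_eq plane setT (u \_ (square 1)) (v \_ (square 1)) ->
    ae_eq plane_measure (square 1) u v.
  by apply: filterS => t /(_ Logic.I) + /mem_set t1; rewrite !patchE t1.
have [||||||] :=
  @convolution_sqr_inj R (x \_ (square 1)) (xdag \_ (square 1)).
- exact: inL2_integrable.
- exact: restrict_notin.
- exact: inL2_integrable.
- exact: restrict_notin.
(* Here [y] is eliminated: both autoconvolutions agree with it almost everywhere on [square 2]. *)
- exact: ae_eq_trans xy (ae_eq_sym xdagy).
- by left; exact: sub1.
- by rewrite -opp_restrict => ?; right; exact: sub1.
Qed.
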